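(* Let $C_s$ be an $s$-cycle and let $I(C_s)$ be its edge ideal. Then ${\rm v}(I(C_s))\leq{\rm im}(C_s)$ if and only if $s\neq 5$.
   Context: An $s$-cycle $C_s$ (with $s\ge 3$, graphs being simple) is the graph with vertices $t_1,\ldots,t_s$ and edges $\{t_i,t_{i+1}\}$ for $1\le i<s$ together with $\{t_s,t_1\}$. For a graph $G$ with vertex set $\{t_1,\ldots,t_s\}$ and a field $K$, let $S=K[t_1,\ldots,t_s]$ with the standard grading $S=\bigoplus_{d\ge0}S_d$; the edge ideal is $I(G)=(t_it_j\mid\{t_i,t_j\}\in E(G))\subset S$. For a graded ideal $I\subset S$, ${\rm Ass}(I)$ is the set of associated primes of $S/I$, and the v-number is ${\rm v}(I)=\min\{d\geq 0\mid\exists\, f\in S_d,\ \mathfrak{p}\in{\rm Ass}(I)\text{ with }(I\colon f)=\mathfrak{p}\}$, where $(I\colon f)=\{g\in S\mid gf\in I\}$. A matching of $G$ is a set of pairwise disjoint edges; it is an induced matching if the only edges of $G$ contained in the union of its edges are the edges of the matching. ${\rm im}(G)$ is the number of edges in a largest induced matching of $G$. *)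

(* Defs.v *)
From mathcomp Require Import all_boot all_order all_algebra.
From mathcomp Require Import boolp.
From mathcomp Require Import mpoly.
From Stdlib Require Import ClassicalEpsilon.

Set Implicit Arguments.
Unset Strict Implicit.
Unset Printing Implicit Defensive.

Import GRing.Theory.
Local Open Scope ring_scope.

Section Ideals.
Variable R : comNzRingType.
Implicit Types (A : R -> Prop) (I p : {pred R}).

Definition gen_ideal A : {pred R} :=
  [pred f | `[< exists r : seq (R * R),
    (forall x, x \in r -> A x.2) /\ f = \sum_(x <- r) x.1 * x.2 >]].

Definition colon I (f : R) : {pred R} := [pred g | g * f \in I].

(* [idealr_closed] already includes [1 \notin p]. *)
Definition prime_ideal p : Prop := idealr_closed p /\ prime_idealr_closed p.

(* [colon I g] is the annihilator of the class of [g] in the quotient by [I]. *)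
Definition associated_prime I p : Prop :=
  prime_ideal p /\ exists g, colon I g =i p.

End Ideals.

Section VNumber.
Variables (K : fieldType) (n : nat).
Implicit Type I : {pred {mpoly K[n]}}.

Definition vdegree I (d : nat) : Prop :=
  exists (f : {mpoly K[n]}) (p : {pred {mpoly K[n]}}),
    [/\ f \is d.-homog, associated_prime I p & colon I f =i p].

Definition is_vnumber I (v : nat) : Prop :=
  vdegree I v /\ forall d, vdegree I d -> (v <= d)%N.

(* Unspecified when no degree qualifies; see [vnumberP]. *)
Definition vnumber I : nat := epsilon (inhabits 0%N) (is_vnumber I).

Lemma vnumberP I : (exists d, vdegree I d) -> is_vnumber I (vnumber I).
Proof.
move=> [d Hd]; apply: epsilon_spec.
have ex : exists d, `[< vdegree I d >] by exists d; apply/asboolP.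
case: (ex_minnP ex) => v /asboolP Hv Hmin.
by exists v; split => // e He; apply: Hmin; apply/asboolP.
Qed.

End VNumber.

(* A graph on a finite vertex type is given by its set of edges, which are
   sets of two vertices. *)
Section Graphs.
Variable V : finType.
Implicit Types E M : {set {set V}}.

Definition matching E M : bool := (M \subset E) && trivIset M.

Definition induced_matching E M : bool :=
  matching E M && [forall e in E, (e \subset cover M) ==> (e \in M)].

Definition im E : nat := \max_(M : {set {set V}} | induced_matching E M) #|M|.

End Graphs.

Definition edge_ideal (K : fieldType) n (E : {set {set 'I_n}}) :
    {pred {mpoly K[n]}} :=
  gen_ideal (fun g => exists i j : 'I_n, [set i; j] \in E /\ g = 'X_i * 'X_j).

Arguments edge_ideal K {n} E.

(* Vertices are numbered from 0, so the closing edge joins [s.-1] and [0]. *)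
Definition cycle_edges s : {set {set 'I_s}} :=
  [set [set x.1; x.2] | x in [set x : 'I_s * 'I_s |
     (x.1.+1 == x.2 :> nat) || (x.1.+1 == s) && (x.2 == 0%N :> nat)]].

Lemma cycle_edges_simple s (e : {set 'I_s}) :
  (2 < s)%N -> e \in cycle_edges s -> #|e| = 2%N.
Proof.
move=> s_gt2 /imsetP [[i j]]; rewrite inE /= => Hij ->.
rewrite cards2; suff -> : i != j by [].
apply/eqP => eij; subst j; case/orP: Hij => [|/andP [/eqP Hs /eqP H0]].
  by rewrite -[X in _ == X]add0n -add1n eqn_add2r.
by move: s_gt2; rewrite -Hs H0.
Qed.

(* Main.v *)
Require Import Defs.
From mathcomp Require Import all_boot all_order all_algebra.
From mathcomp Require Import boolp mpoly zify ring.

Set Implicit Arguments.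
Unset Strict Implicit.
Unset Printing Implicit Defensive.

Import GRing.Theory.

(** The proof compares both invariants with the quotient of s by 3.

    Upper bounds for the v-number come from monomials.  Let A be a stable set
    of vertices whose set N of neighbours meets every edge, and let f be the
    product of the variables in A.  Then (I : f) is generated by the variables
    in N, hence is prime, and f has degree #|A| (vdegree_stable_cover).  On a
    cycle such an A is a set of vertices whose consecutive gaps are all 2, 3
    or 4 (vdegree_gaps).  Write s = 3 q + r with r < 3.  As soon as r <= q, the
    cycle splits into r gaps of length 4 and q - r gaps of length 3, so that
    the v-number is at most q.  For s >= 3 the condition r <= q fails only when
    q = 1 and r = 2, that is, when s = 5.  On the other side, the q edges
    {3 k, 3 k + 1} form an induced matching (im_cycle_ge), so that
    v <= q <= im for s <> 5.

    For s = 5, any two edges of the pentagon share a vertex or are joined by an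
    edge, so that im <= 1 (im_cycle5), whereas the v-number is at least 2.
    Indeed let f be homogeneous with (I : f) prime.  A prime containing
    X_u X_v contains X_u or X_v, so for each edge one of its ends w satisfies
    X_w f \in I.  As I is a monomial ideal, a monomial m of f then has
    X_w m divisible by the product of an edge (vdegree_monomial).  This forces
    deg m > 0 (vdegree_gt0), and if m is a variable X_x, every edge must have
    an end adjacent to x (vdegree1_star); the edge of the pentagon opposite
    to x has none. *)

(** * Edge ideals *)

Section EdgeIdeal.
Local Open Scope ring_scope.
Variables (K : fieldType) (n : nat) (E : {set {set 'I_n}}).
Implicit Types (f g h : {mpoly K[n]}) (A : {set 'I_n}).

Local Notation I := (edge_ideal K E).

Lemma edge_idealP f :
  reflect (exists r : seq ({mpoly K[n]} * {mpoly K[n]}),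
     (forall x, x \in r -> exists i j : 'I_n,
        [set i; j] \in E /\ x.2 = 'X_i * 'X_j) /\
     f = \sum_(x <- r) x.1 * x.2) (f \in I).
Proof. by rewrite inE; apply: asboolP. Qed.

Lemma edge_ideal_gen (i j : 'I_n) : [set i; j] \in E -> 'X_i * 'X_j \in I.
Proof.
move=> Eij; apply/edge_idealP; exists [:: (1, 'X_i * 'X_j)]; split.
  by move=> x; rewrite inE => /eqP ->; exists i, j.
by rewrite big_seq1 mul1r.
Qed.

Lemma edge_ideal0 : 0 \in I.
Proof. by apply/edge_idealP; exists [::]; rewrite big_nil. Qed.

Lemma edge_idealD f g : f \in I -> g \in I -> f + g \in I.
Proof.
move=> /edge_idealP[r [hr ->]] /edge_idealP[t [ht ->]].
apply/edge_idealP; exists (r ++ t); split; last by rewrite big_cat.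
by move=> x; rewrite mem_cat => /orP[]; [apply: hr | apply: ht].
Qed.

Lemma edge_idealM f g : g \in I -> f * g \in I.
Proof.
move=> /edge_idealP[r [hr ->]].
apply/edge_idealP; exists [seq (f * x.1, x.2) | x <- r]; split.
  by move=> _ /mapP[x xr ->]; apply: (hr x xr).
by rewrite big_map mulr_sumr; apply: eq_bigr => x _; rewrite mulrA.
Qed.

Lemma mdeg_subm (m1 m2 : 'X_{1..n}) :
  (m1 <= m2)%MM -> (mdeg (m2 - m1) + mdeg m1 = mdeg m2)%N.
Proof. by move=> le_m; rewrite -mdegD submK. Qed.

(** This is where it matters that the ideal is generated by monomials. *)
Lemma edge_ideal_msupp f m : f \in I -> m \in msupp f ->
  exists i j : 'I_n, [set i; j] \in E /\ (U_(i) + U_(j) <= m)%MM.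
Proof.
move=> /edge_idealP[r [hr ->]] hm.
have /flatten_mapP[x xr] := msupp_sum_le hm.
rewrite filter_predT in xr.
have [i [j [Eij ->]]] := hr x xr.
rewrite -mpolyXD (perm_mem (msuppMX _ _)) => /mapP[m' _ ->].
by exists i, j; split=> //; apply: lem_addr.
Qed.

(** * Colon ideals by squarefree monomials *)

Definition neighbors A : {set 'I_n} :=
  [set j | [exists i in A, [set i; j] \in E]].

(** Composing with this tuple is the evaluation homomorphism that sends the
    variables in A to 0 and fixes the others; its kernel is the prime ideal
    generated by the variables in A. *)
Definition vanish A : n.-tuple {mpoly K[n]} :=
  [tuple (if i \in A then 0 else 'X_i) | i < n].

Lemma vanishX A i : 'X_i \mPo vanish A = if i \in A then 0 else 'X_i.
Proof. by rewrite comp_mpolyXU -tnth_nth tnth_mktuple. Qed.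

(** The kernel of the evaluation is generated by the variables in A.  The
    statement is put in terms of I and f because g - vanish g then lies in
    (I : f) as soon as these variables do.  The polynomials g with this
    property are closed under sums and products, hence it suffices to look at
    variables. *)
Lemma vanish_congr A f g : (forall i, i \in A -> 'X_i * f \in I) ->
  (g - (g \mPo vanish A)) * f \in I.
Proof.
move=> XfI; pose Q h := (h - (h \mPo vanish A)) * f \in I.
have QM u v : Q u -> Q v -> Q (u * v).
  rewrite /Q rmorphM /=.
  set u' := u \mPo _; set v' := v \mPo _ => Qu Qv.
  have -> : (u * v - u' * v') * f = v * ((u - u') * f) + u' * ((v - v') * f).
    by ring.
  exact: edge_idealD (edge_idealM v Qu) (edge_idealM u' Qv).
have Q1 : Q 1 by rewrite /Q comp_mpoly1 subrr mul0r edge_ideal0.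
have QX i : Q 'X_i.
  rewrite /Q vanishX; case: ifPn => iA; first by rewrite subr0 XfI.
  by rewrite subrr mul0r edge_ideal0.
rewrite -/(Q g); elim/mpolyind: g => [|c m p _ _ Qp].
  by rewrite /Q comp_mpoly0 subrr mul0r edge_ideal0.
rewrite /Q linearP /= opprD addrACA mulrDl.
apply: edge_idealD Qp.
rewrite -scalerBr -mul_mpolyC -mulrA; apply: edge_idealM.
rewrite -/(Q _) mpolyXE_id; apply: (big_ind Q Q1 QM) => i _.
elim: (m i) => [|k IHk]; first by rewrite expr0; exact: Q1.
by rewrite exprS; exact: QM _ _ (QX i) IHk.
Qed.

(** With N the neighbours of A and f the product of the variables in A, the
    ideal (I : f) is the kernel of the evaluation at 0 of the variables in N.
    The evaluation fixes f because A is stable, and annihilates I because N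
    meets every edge; hence it annihilates every g with g f \in I.  The
    converse is vanish_congr.  A kernel of a homomorphism to a domain is
    prime. *)
Lemma vdegree_stable_cover A :
  [disjoint A & neighbors A] ->
  (forall i j, [set i; j] \in E -> (i \in neighbors A) || (j \in neighbors A)) ->
  vdegree I #|A|.
Proof.
move=> Astab cover; set N := neighbors A.
pose f : {mpoly K[n]} := \prod_(i in A) 'X_i.
have fE : f = 'X_[\sum_(i in A) U_(i)] by rewrite -mprodXE.
have f_neq0 : f != 0 by rewrite fE -msupp_eq0 msuppX.
have f_fix : f \mPo vanish N = f.
  rewrite rmorph_prod; apply: eq_bigr => i iA /=.
  by rewrite vanishX (disjointFr Astab iA).
have I_vanish g : g \in I -> g \mPo vanish N = 0.
  move=> /edge_idealP[r [hr ->]]; rewrite raddf_sum /= big_seq big1 // => x xr.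
  have [i [j [/cover Nij ->]]] := hr x xr.
  rewrite !rmorphM /= !vanishX.
  by case/orP: Nij => ->; rewrite ?mul0r ?mulr0.
have NI i : i \in N -> 'X_i * f \in I.
  rewrite inE => /exists_inP[j jA Eji].
  rewrite /f (bigD1 j) //= mulrA mulrC; apply: edge_idealM.
  by rewrite mulrC; apply: edge_ideal_gen.
have colonE g : (g \in colon I f) = (g \mPo vanish N == 0).
  rewrite inE; apply/idP/eqP => [/I_vanish|g0].
    rewrite rmorphM /= f_fix => /eqP.
    by rewrite mulf_eq0 (negPf f_neq0) orbF => /eqP.
  by have := vanish_congr g NI; rewrite g0 subr0.
exists f, (colon I f); split=> //.
- rewrite fE dhomogX /= mdeg_sum.
  by under eq_bigr do rewrite mdeg1; rewrite sum1_card.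
- split; last by exists f.
  split; first split.
  + by rewrite colonE comp_mpoly0.
  + by rewrite colonE comp_mpoly1 oner_eq0.
  + move=> a u v; rewrite !colonE => /eqP u0 /eqP v0.
    by rewrite comp_mpolyD rmorphM /= u0 v0 mulr0 addr0.
  + by move=> u v; rewrite !colonE rmorphM /= mulf_eq0.
Qed.

(** * Lower bounds for the v-number *)

(** Turns primality into combinatorics: all that is used of
    p = (I : f) is that it is proper, so that f has a monomial, that it
    contains one end of each edge, and that X_w f \in I passes to the
    monomials of f.  Any monomial of f would do;
    the leading one is at hand. *)
Lemma vdegree_monomial d : vdegree I d ->
  exists2 m : 'X_{1..n}, mdeg m = d & forall u v : 'I_n, [set u; v] \in E ->
    exists2 w, w \in [set u; v] & exists i j : 'I_n,
      [set i; j] \in E /\ (U_(i) + U_(j) <= U_(w) + m)%MM.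
Proof.
move=> [f [p [f_homog [[[_ p1 _] p_prime] _] pE]]].
have f_neq0 : f != 0.
  apply: contraNneq p1 => f0.
  by rewrite -pE f0 inE mulr0 edge_ideal0.
exists (mlead f) => [|u v Euv].
  by move/dhomogP: f_homog => /(_ _ (mlead_supp f_neq0)).
have : 'X_u * 'X_v \in p.
  by rewrite -pE inE mulrC; apply: edge_idealM; apply: edge_ideal_gen.
have key w : 'X_w \in p -> exists i j : 'I_n,
    [set i; j] \in E /\ (U_(i) + U_(j) <= U_(w) + mlead f)%MM.
  rewrite -pE inE => /edge_ideal_msupp; apply.
  by rewrite mulrC mcoeff_msupp mcoeffMX -mcoeff_msupp mlead_supp.
by case/p_prime/orP => /key; [exists u|exists v]; rewrite // !inE eqxx ?orbT.
Qed.

(** For a constant f, the variable X_w alone would have to be divisible by a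
    product of two variables. *)
Lemma vdegree_gt0 d : (exists u v : 'I_n, [set u; v] \in E) ->
  vdegree I d -> (0 < d)%N.
Proof.
move=> [u [v Euv]] /vdegree_monomial[m <- /(_ u v Euv)[w _ [i [j [_ le_m]]]]].
by have := mdeg_subm le_m; rewrite !mdegD !mdeg1; lia.
Qed.

(** X_i X_j divides X_w X_x only if the two products are equal, so the edge
    {i, j} must be {w, x}. *)
Lemma vdegree1_star : vdegree I 1 -> exists x : 'I_n,
  forall u v : 'I_n, [set u; v] \in E ->
    exists2 w, w \in [set u; v] & [set w; x] \in E.
Proof.
move=> /vdegree_monomial[m /eqP/mdeg1P[x /eqP ->] hE].
exists x => u v /hE[w wuv [i [j [Eij le_wx]]]]; exists w => //.
suff /eqP : (U_(i) + U_(j) == U_(w) + U_(x))%MM.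
  move=> /mnmP eqU; move: Eij; congr (_ \in E); apply/setP => y.
  move: (eqU y); rewrite !mnmDE !mnmE !inE ![y == _]eq_sym.
  by case: (i == y); case: (j == y); case: (w == y); case: (x == y).
(* a divisor of the same degree leaves a cofactor of degree 0 *)
rewrite -(submK le_wx) -{1}[X in X == _]add0m eqm_add2r eq_sym -mdeg_eq0.
by have := mdeg_subm le_wx; rewrite !mdegD !mdeg1; lia.
Qed.

End EdgeIdeal.

(** * Induced matchings *)

Section Graph.
Variables (V : finType) (E : {set {set V}}).
Implicit Types (M : {set {set V}}) (e : {set V}).

(** An edge joining two members of an induced matching belongs to it, and then
    meets, hence equals, both of them. *)
Lemma induced_matching_sep M e e' u v : induced_matching E M ->
  e \in M -> e' \in M -> u \in e -> v \in e' ->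
  (u == v) || ([set u; v] \in E) -> e = e'.
Proof.
move=> /andP[/andP[_ /trivIsetP triv] /forall_inP ind] eM e'M ue ve'.
have same a b x : a \in M -> b \in M -> x \in a -> x \in b -> a = b.
  move=> aM bM xa xb; apply/eqP; apply: contraT => /(triv _ _ aM bM) ab.
  by rewrite (disjointFr ab xa) in xb.
case/orP => [/eqP uv|Euv]; first by apply: (same _ _ u) => //; rewrite uv.
have uvM : [set u; v] \in M.
  apply: (implyP (ind _ Euv)); apply/subsetP => x.
  by rewrite !inE => /orP[] /eqP->; apply/bigcupP; [exists e|exists e'].
by rewrite (same _ _ _ eM uvM ue (set21 _ _)) (same _ _ _ e'M uvM ve' (set22 _ _)).
Qed.

End Graph.

(** * Cycles *)

Lemma set2_inj (T : finType) (a b c d : T) : [set a; b] = [set c; d] ->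
  (a = c /\ b = d) \/ (a = d /\ b = c).
Proof.
move=> eqS; have := set21 a b; have := set22 a b.
have := set21 c d; have := set22 c d; rewrite -eqS !inE => hd hc.
rewrite -!in_set2 eqS !inE => hb ha.
case: (eqVneq a c) hc hb ha hd => [->|_] /=;
  by do 3!case: eqVneq => // ?; auto; congruence.
Qed.

Section Cycle.
Variable s : nat.
Implicit Types i j : 'I_s.

Definition cycle_next i j : bool :=
  (i.+1 == j :> nat) || (i.+1 == s) && (j == 0 :> nat).

Lemma cycle_edgesP i j :
  reflect (cycle_next i j \/ cycle_next j i) ([set i; j] \in cycle_edges s).
Proof.
apply: (iffP imsetP) => [[[x y]]|].
  by rewrite inE => xy /set2_inj[] [-> ->]; [left|right].
case=> ij; first by exists (i, j); rewrite ?inE.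
by exists (j, i); rewrite ?inE // setUC.
Qed.

(** The vertices a 0, ..., a q.-1 cut the cycle into q arcs, with a q = s
    standing for a 0 once around.  Gaps of at least 2 make them stable; in a gap
    of at most 4, at most one of the vertices strictly inside is adjacent to
    neither end of the gap, so every edge has an end that is adjacent to a
    chosen vertex. *)
Lemma vdegree_gaps (K : fieldType) (q : nat) (a : nat -> nat) :
  2 < s -> a 0 = 0 -> a q = s ->
  (forall k, k < q -> a k + 2 <= a k.+1 <= a k + 4) ->
  exists2 d, d <= q & vdegree (edge_ideal K (cycle_edges s)) d.
Proof.
move=> s_gt2 a0 aq gap.
pose A := [set i : 'I_s | val i \in [seq a k | k <- iota 0 q]].
have AP i : reflect (exists2 k, k < q & a k = i) (i \in A).
  rewrite inE; apply: (iffP mapP) => -[k]; first by rewrite mem_iota; exists k.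
  by exists k; rewrite ?mem_iota.
have a_ge k l : k + l <= q -> a k + 2 * l <= a (k + l).
  elim: l => [|l IH] le_q; first by rewrite addn0 muln0 addn0.
  rewrite addnS in le_q *.
  by have /andP[] := gap _ le_q; have := IH (ltnW le_q); lia.
have lt_a k l : k < l -> l <= q -> a k + 2 <= a l.
  by move=> kl lq; have := a_ge k (l - k); rewrite subnKC; lia.
have le_a k l : k <= l -> l <= q -> a k <= a l.
  by move=> kl lq; have := a_ge k (l - k); rewrite subnKC; lia.
have adjN i j : cycle_next i j || cycle_next j i -> i \in A ->
    j \in neighbors (cycle_edges s) A.
  move=> /orP ij iA; rewrite inE; apply/exists_inP; exists i => //.
  exact/cycle_edgesP.
have after k (i : 'I_s) : k < q -> a k + 1 = i ->
    i \in neighbors (cycle_edges s) A.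
  move=> kq aki; have ak_lt : a k < s by have := ltn_ord i; lia.
  apply: (adjN (Ordinal ak_lt)); last by apply/AP; exists k.
  by rewrite /cycle_next /=; lia.
have before k (i : 'I_s) : k < q -> i.+1 = a k.+1 ->
    i \in neighbors (cycle_edges s) A.
  move=> kq iak; have [lt_q|ge_q] := ltnP k.+1 q.
    have ak_lt : a k.+1 < s by have := lt_a _ _ lt_q (leqnn q); lia.
    apply: (adjN (Ordinal ak_lt)); last by apply/AP; exists k.+1.
    by rewrite /cycle_next /=; lia.
  (* the arc is the last one, and its right end a q = s is the vertex 0 *)
  have kq1 : k.+1 = q by lia.
  have s_gt0 : 0 < s by lia.
  apply: (adjN (Ordinal s_gt0)); last by apply/AP; exists 0; rewrite ?a0 //; lia.
  by rewrite /cycle_next /=; move: iak; rewrite kq1 aq; lia.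
have block i : i < s -> exists2 k, k < q & a k <= i < a k.+1.
  suff ex p : i < a p -> exists2 k, k < p & a k <= i < a k.+1.
    by move=> lt_i; apply: ex; rewrite aq.
  elim: p => [|p IH]; first by rewrite a0.
  case: (ltnP i (a p)) => [/IH[k kp hk] _|ge_i lt_i].
    by exists k => //; apply: ltnW.
  by exists p; rewrite ?ge_i.
exists #|A|.
  rewrite cardE -(size_map (@nat_of_ord s)) -(size_iota 0 q) -[leqRHS](size_map a).
  apply: uniq_leq_size; first by rewrite (map_inj_uniq (@ord_inj s)) enum_uniq.
  by move=> _ /mapP[i iA ->]; move: iA; rewrite mem_enum inE.
have AnextA i j : i \in A -> j \in A -> cycle_next i j -> False.
  move=> /AP[k kq ki] /AP[l lq lj]; rewrite /cycle_next.
  have := lt_a k q kq (leqnn q); rewrite aq => ak_s.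
  case: (ltnP k l) => [kl|lk].
    by have := lt_a k l kl (ltnW lq); lia.
  by have := le_a l k lk (ltnW kq); lia.
apply: vdegree_stable_cover.
  rewrite -setI_eq0; apply/eqP/setP => j; rewrite in_setI in_set0.
  apply/negP => /andP[jA]; rewrite inE => /exists_inP[i iA].
  by case/cycle_edgesP; [apply: AnextA iA jA | apply: AnextA jA iA].
have cover i j : cycle_next i j -> (i \in neighbors (cycle_edges s) A) ||
    (j \in neighbors (cycle_edges s) A).
  move=> ij; have [k kq ki] := block i (ltn_ord i).
  have := gap k kq => gk.
  (* i is at distance 0, 1, 2 or 3 from the start of its arc; at distance 0
     or at distance 2 in an arc of length 4, the covering end is j *)
  have [ik|ik] := eqVneq (nat_of_ord i) (a k).
    by rewrite orbC (adjN i) ?ij //; apply/AP; exists k.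
  have [ik1|ik1] := eqVneq (nat_of_ord i) (a k + 1); first by rewrite (after k).
  have [ik2|ik2] := eqVneq (i.+1) (a k.+1); first by rewrite (before k).
  rewrite orbC (before k) //.
  have := le_a k.+1 q kq (leqnn q); have := ltn_ord i.
  by move: ij; rewrite /cycle_next aq; lia.
by move=> i j /cycle_edgesP[/cover//|/cover]; rewrite orbC.
Qed.

(** The edges {3 k, 3 k + 1} leave out every vertex congruent to 2 modulo 3 and
    every vertex from 3 (s %/ 3) on, in particular one vertex between any two
    consecutive edges. *)
Lemma im_cycle_ge : 2 < s -> s %/ 3 <= im (cycle_edges s).
Proof.
move=> s_gt2; set q := s %/ 3.
have q3 : 3 * q <= s by rewrite /q; lia.
have lt0 (k : 'I_q) : 3 * k < s by have := ltn_ord k; lia.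
have lt1 (k : 'I_q) : 3 * k + 1 < s by have := ltn_ord k; lia.
pose e k : {set 'I_s} := [set Ordinal (lt0 k); Ordinal (lt1 k)].
have eP k i : (i \in e k) = (i == 3 * k :> nat) || (i == 3 * k + 1 :> nat).
  by rewrite !inE -!val_eqE.
have e_uniq k l i : i \in e k -> i \in e l -> k = l.
  by rewrite !eP => ik il; apply: val_inj => /=; lia.
have e_inj : injective e.
  by move=> k l ekl; apply: (e_uniq k l (Ordinal (lt0 k))); rewrite -?ekl set21.
rewrite -[X in X <= _]card_ord -(card_imset _ e_inj).
apply: (leq_bigmax_cond (F := fun M : {set {set 'I_s}} => #|M|)).
apply/andP; split; first apply/andP; first split.
- apply/subsetP => _ /imsetP[k _ ->]; apply/cycle_edgesP; left.
  by rewrite /cycle_next /=; lia.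
- apply/trivIsetP => _ _ /imsetP[k _ ->] /imsetP[l _ ->] ne_kl.
  apply/pred0P => i /=; apply/negP => /andP[ik il].
  by rewrite (e_uniq k l i ik il) eqxx in ne_kl.
have coverP i : i \in cover [set e k | k in 'I_q] -> exists k, i \in e k.
  by move=> /bigcupP[_ /imsetP[k _ ->] ik]; exists k.
have step i j : cycle_next i j -> i \in cover [set e k | k in 'I_q] ->
    j \in cover [set e k | k in 'I_q] -> [set i; j] \in [set e k | k in 'I_q].
  move=> ij /coverP[k ik] /coverP[l jl]; apply/imsetP; exists k => //.
  have hk := ltn_ord k; move: ij ik jl; rewrite /cycle_next !eP => ij ik jl.
  have [i0 j1] : i = 3 * k :> nat /\ j = 3 * k + 1 :> nat by lia.
  by congr [set _; _]; apply: val_inj.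
apply/forall_inP => f /imsetP[[i j]]; rewrite inE /= => ij ->.
apply/implyP => /subsetP sub.
by apply: step => //; apply: sub; rewrite !inE eqxx ?orbT.
Qed.

End Cycle.

(** * The pentagon *)

(** Two edges of the pentagon always share a vertex or are joined by an
    edge. *)
Lemma im_cycle5 : im (cycle_edges 5) <= 1.
Proof.
apply/bigmax_leqP => M indM; apply/card_le1_eqP => f e fM eM.
have [/subsetP subE _] := andP (andP indM).1.
have /imsetP[[i j]] := subE _ eM; rewrite inE /= => ij eE.
have /imsetP[[k l]] := subE _ fM; rewrite inE /= => kl fE.
have close u v : u \in e -> v \in f ->
    [|| u == v, cycle_next u v | cycle_next v u] -> e = f.
  move=> ue vf uv; apply: (induced_matching_sep indM eM fM ue vf).
  case/orP: uv => [->//|/orP uv]; apply/orP; right; exact/cycle_edgesP.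
have [ie je] : i \in e /\ j \in e by rewrite eE set21 set22.
have [kf lf] : k \in f /\ l \in f by rewrite fE set21 set22.
have : [|| i == k, i == l, j == k, cycle_next j k | cycle_next l i].
  have := (ltn_ord i, ltn_ord j, ltn_ord k, ltn_ord l) => -[[[? ?] ?] ?].
  by move: ij kl; rewrite /cycle_next -!val_eqE /=; lia.
move=> /orP[h|/orP[h|/orP[h|/orP[h|h]]]].
- by apply: (close i k ie kf); rewrite h.
- by apply: (close i l ie lf); rewrite h.
- by apply: (close j k je kf); rewrite h.
- by apply: (close j k je kf); rewrite h orbT.
- by apply: (close i l ie lf); rewrite h !orbT.
Qed.

(** The edge {x + 2, x + 3}, modulo 5, has no end adjacent to x. *)
Lemma cycle5_no_vdegree1 (K : fieldType) :
  ~ vdegree (edge_ideal K (cycle_edges 5)) 1.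
Proof.
move=> /vdegree1_star[x star].
have lt5 k : k %% 5 < 5 by rewrite ltn_mod.
pose u := Ordinal (lt5 (x + 2)); pose v := Ordinal (lt5 (x + 3)).
have := ltn_ord x => x5.
have Euv : [set u; v] \in cycle_edges 5.
  by apply/cycle_edgesP; left; rewrite /cycle_next /=; lia.
have [w] := star u v Euv; rewrite !inE => wuv /cycle_edgesP.
by case: (orP wuv) => /eqP ->; rewrite /cycle_next /= => -[]; lia.
Qed.

(** * Comparison of the two invariants *)

Theorem theorem4p6 (K : fieldType) (s : nat) (hs : (3 <= s)%N) :
  (vnumber (edge_ideal K (cycle_edges s)) <= im (cycle_edges s))%N <-> s <> 5%N.
Proof.
split=> [le_v s5 | s_neq5].
  subst s.
  (* some degree must be attained for the v-number to be a minimum: the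
     pentagon has the gaps 2 and 3 *)
  have [] := @vdegree_gaps 5 K 2 (nth 0 [:: 0; 2; 5]) hs erefl erefl.
    by do 2?case.
  move=> d _ vd; have [vv _] := vnumberP (ex_intro _ d vd).
  have v_le1 := leq_trans le_v im_cycle5.
  have v_gt0 : 0 < vnumber (edge_ideal K (cycle_edges 5)).
    apply: vdegree_gt0 vv; exists ord0, (Ordinal (isT : 1 < 5)).
    by apply/cycle_edgesP; left.
  have v1 : vnumber (edge_ideal K (cycle_edges 5)) = 1.
    by apply/eqP; rewrite eqn_leq v_le1.
  by rewrite v1 in vv; exact: cycle5_no_vdegree1 vv.
(* the first s %% 3 gaps have length 4 and the others 3; they add up to s because
   s %% 3 <= s %/ 3 *)
have [|||d d_le vd] := @vdegree_gaps s K (s %/ 3)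
  (fun k => 3 * k + minn k (s %% 3)) hs.
- by lia.
- by lia.
- by move=> k; lia.
have [_ v_min] := vnumberP (ex_intro _ d vd).
exact: leq_trans (v_min d vd) (leq_trans d_le (im_cycle_ge hs)).
Qed.
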